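(* Let $X\sim\chi$ be a random database in $D$, let $\epsilon>0$, $\delta\in[0,1]$, and let $f$ be a (deterministic or randomized) real-valued query on $D$ that is inherently $(\epsilon,\delta)$-differentially private relative to $\chi$. Let $g$ be an arbitrary deterministic or randomized (measurable) function on $\mathbb{R}$, any randomness in $g$ being independent of $X$ and $f$. Then $g\circ f$ is inherently $(\epsilon,\delta)$-differentially private relative to $\chi$.
   Context: $D$ is a set of databases; each database is a finite set of records carrying identities of individuals, with individuals having a unique identity across $D$. For a random database $X\sim\chi$ with values in $D$ and an individual $i$, $X_i\sim\chi_i$ denotes the random database obtained from $X$ by removing the data of individual $i$, and $X_i\in D$. For a deterministic or randomized query $q$ on $D$ with values in a measurable space, let $P$ be the probability measure of the query result $q(X)$, and $P_i$ that of $q(X_i)$, each including both the query's randomness and the randomness of the database. The query $q$ is inherently $(\epsilon,\delta)$-differentially private relative to $\chi$ if and only if for all individuals $i$ and all measurable sets $E$ of potential query results, $$P_i(E)\le e^{\epsilon}P(E)+\delta\qquad\text{and}\qquad P(E)\le e^{\epsilon}P_i(E)+\delta .$$ *)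

(* Defs.v *)
From HB Require Import structures.
From mathcomp Require Import all_boot all_order all_algebra finmap.
From mathcomp Require Import all_classical all_reals all_analysis.

Set Implicit Arguments.
Unset Strict Implicit.
Unset Printing Implicit Defensive.

Import Order.TTheory GRing.Theory Num.Theory.

Local Open Scope classical_set_scope.
Local Open Scope ring_scope.

(* The type D is a set of databases: each x : D is, faithfully, a finite set
   of records.  The type Ind of individuals serves as the type of identities;
   as owner does not depend on the database, an individual has the same
   identity throughout D.  The existence of remove expresses that D is closed
   under removal of the data of an individual, and its measurability that
   removal turns a random database into a random database.  The sigma-algebra
   on D is arbitrary (possibly discrete). *)
Record database_structure (dD : measure_display) (D : measurableType dD)
    (Rec : choiceType) (Ind : eqType) := DatabaseStructure {
  records : D -> {fset Rec} ;
  records_inj : injective records ;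
  owner : Rec -> Ind ;
  remove : Ind -> {mfun D >-> D} ;
  records_remove : forall (i : Ind) (x : D),
    records (remove i x) = [fset r in records x | owner r != i]%fset }.

Section mfun_pair.
Context (d1 d2 d3 : measure_display) (T1 : measurableType d1)
  (T2 : measurableType d2) (T3 : measurableType d3).

Definition mfun_pair (f : {mfun T1 >-> T2}) (g : {mfun T1 >-> T3})
  : T1 -> T2 * T3 := fun x => (f x, g x).

Let measurable_mfun_pair (f : {mfun T1 >-> T2}) (g : {mfun T1 >-> T3}) :
  measurable_fun [set: T1] (mfun_pair f g).
Proof. by apply/measurable_fun_pairP; split; exact: measurable_funPT. Qed.

HB.instance Definition _ (f : {mfun T1 >-> T2}) (g : {mfun T1 >-> T3}) :=
  isMeasurableFun.Build _ _ _ _ (mfun_pair f g) (measurable_mfun_pair f g).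

End mfun_pair.

Section randomized_map.
Context (dO : measure_display) (Omega : measurableType dO) (R : realType)
  (Pr : probability Omega R).

(* A randomized map from S to T returns run (s, seed) on input s, where the
   seed is a random element of an arbitrary measurable space that carries the
   internal randomness of the map.  All random elements live on Omega, and no
   independence is built in. *)
Record randomized_map (dS dT : measure_display) (S : measurableType dS)
    (T : measurableType dT) := RandomizedMap {
  seed_display : measure_display ;
  seed_space : measurableType seed_display ;
  seed : {RV Pr >-> seed_space} ;
  run : {mfun (S * seed_space)%type >-> T} }.

Definition result (dS dT : measure_display) (S : measurableType dS)
    (T : measurableType dT) (q : randomized_map S T) (X : {RV Pr >-> S}) :
    {RV Pr >-> T} :=
  run q \o mfun_pair X (seed q).

Section deterministic.
Context (dS dT : measure_display) (S : measurableType dS)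
  (T : measurableType dT) (h : {mfun S >-> T}).

Definition deterministic_run : S * unit -> T := h \o fst.

Let measurable_deterministic_run : measurable_fun [set: S * unit] deterministic_run.
Proof. exact: measurableT_comp. Qed.

HB.instance Definition _ := isMeasurableFun.Build _ _ _ _
  deterministic_run measurable_deterministic_run.

Definition deterministic_map : randomized_map S T :=
  RandomizedMap (cst tt : {mfun Omega >-> unit}) deterministic_run.

Lemma result_deterministic (X : {RV Pr >-> S}) :
  result deterministic_map X = h \o X :> (Omega -> T).
Proof. by []. Qed.

End deterministic.

Section composition.
Context (dS dT dU : measure_display) (S : measurableType dS)
  (T : measurableType dT) (U : measurableType dU).
Variables (g : randomized_map T U) (f : randomized_map S T).

Definition comp_run : S * (seed_space f * seed_space g) -> U :=
  fun z => run g (run f (z.1, z.2.1), z.2.2).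

Let measurable_comp_run :
  measurable_fun [set: S * (seed_space f * seed_space g)] comp_run.
Proof.
have m21 : measurable_fun [set: S * (seed_space f * seed_space g)]
    (fst \o snd) by exact: measurableT_comp.
have m22 : measurable_fun [set: S * (seed_space f * seed_space g)]
    (snd \o snd) by exact: measurableT_comp.
apply: (measurableT_comp (f := run g)) => //.
apply/measurable_fun_pairP; split; last exact: m22.
apply: (measurableT_comp (f := run f)) => //.
by apply/measurable_fun_pairP; split; [exact: measurable_fst|exact: m21].
Qed.

HB.instance Definition _ := isMeasurableFun.Build _ _ _ _
  comp_run measurable_comp_run.

Definition randomized_comp : randomized_map S U :=
  RandomizedMap (mfun_pair (seed f) (seed g)) comp_run.

Lemma result_comp (X : {RV Pr >-> S}) :
  result randomized_comp X = result g (result f X) :> (Omega -> U).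
Proof. by []. Qed.

End composition.

Definition independent_RVs (dS dT : measure_display) (S : measurableType dS)
    (T : measurableType dT) (V : {RV Pr >-> S}) (W : {RV Pr >-> T}) : Prop :=
  forall (A : set S) (B : set T), measurable A -> measurable B ->
    Pr (V @^-1` A `&` W @^-1` B) = (Pr (V @^-1` A) * Pr (W @^-1` B))%E.

(* The distribution chi of the random database is the law of X.  The predicate
   takes X itself because the seed of q need not be independent of X; when it
   is, P and P_i depend on X only through chi. *)
Definition inherently_private (dD dT : measure_display)
    (D : measurableType dD) (T : measurableType dT) (Rec : choiceType)
    (Ind : eqType) (DB : database_structure D Rec Ind)
    (X : {RV Pr >-> D}) (eps delta : R) (q : randomized_map D T) : Prop :=
  forall i : Ind,
    let P := distribution Pr (result q X) in
    let P_i := distribution Pr (result q (remove DB i \o X)) in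
    forall E : set T, measurable E ->
      (P_i E <= (expR eps)%:E * P E + delta%:E)%E /\
      (P E <= (expR eps)%:E * P_i E + delta%:E)%E.

End randomized_map.

(* Main.v *)
(* As the seed of [g] is independent of [(X, seed f)], the joint law of that seed
   and of the result of [f] is a product measure, on [X] as well as on [X_i].
   By Fubini-Tonelli, the law of the composite at [E] is the average over the
   seed of the law of [f] at a section of the preimage of [E]; the privacy
   inequality holds at every section, hence for the average. *)
Require Import Defs.
From HB Require Import structures.
From mathcomp Require Import all_boot all_order all_algebra finmap.
From mathcomp Require Import all_classical all_reals all_analysis.
From mathcomp Require Import measurable_realfun.

Set Implicit Arguments.
Unset Strict Implicit.
Unset Printing Implicit Defensive.

Import Order.TTheory GRing.Theory Num.Theory.

Local Open Scope classical_set_scope.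
Local Open Scope ring_scope.

(** Both product measures integrate over [Q] the mass of the sections of [A], so the bound is used
    at each section. As [Q] has mass 1, averaging leaves [delta] unchanged. *)
Lemma product_measure1_le d1 d2 (T1 : measurableType d1)
    (T2 : measurableType d2) (R : realType) (Q : probability T1 R)
    (m m' : probability T2 R) (c delta : R) :
  0 <= c -> 0 <= delta ->
  (forall B, measurable B -> (m B <= c%:E * m' B + delta%:E)%E) ->
  forall A, measurable A ->
    ((Q \x m) A <= c%:E * (Q \x m') A + delta%:E)%E.
Proof.
move=> c0 delta0 mm' A mA.
have mxs (mu : probability T2 R) :
    measurable_fun [set: T1] (mu \o xsection A).
  exact: measurable_fun_xsection.
(* Turning [delta] into an integral makes the right-hand side a single integral over [Q], so that
   monotonicity applies. *)
have -> : delta%:E = (\int[Q]_x (cst delta%:E) x)%E.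
  by rewrite integral_cst// [X in (_ * X)%E]probability_setT mule1.
rewrite /product_measure1 -ge0_integralZl_EFin//.
rewrite -ge0_integralD//; last 2 first.
- by move=> w _; rewrite mule_ge0// lee_fin.
- exact: measurable_funeM.
apply: ge0_le_integral => //.
- by apply: emeasurable_funD => //; exact: measurable_funeM.
- by move=> w _; apply: mm'; exact: measurable_xsection.
Qed.

Section randomized_postprocessing.
Context (dO : measure_display) (Omega : measurableType dO) (R : realType)
  (Pr : probability Omega R).

Lemma independent_RVs_comp (d1 d2 d3 : measure_display)
    (T1 : measurableType d1) (T2 : measurableType d2) (T3 : measurableType d3)
    (V : {RV Pr >-> T1}) (W : {RV Pr >-> T2}) (Z : {RV Pr >-> T3})
    (h : T2 -> T3) :
  measurable_fun setT h -> Z = h \o W :> (Omega -> T3) ->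
  independent_RVs V W -> independent_RVs V Z.
Proof.
move=> mh ZE VW A B mA mB; rewrite ZE.
by apply: (VW A (h @^-1` B)) => //; rewrite -[_ @^-1` _]setTI; exact: mh.
Qed.

(** Independence is agreement of the two measures on measurable rectangles, and this determines the
    product measure. *)
Lemma distribution_mfun_pair (d1 d2 : measure_display)
    (T1 : measurableType d1) (T2 : measurableType d2)
    (V : {RV Pr >-> T1}) (W : {RV Pr >-> T2}) :
  independent_RVs V W -> forall A, measurable A ->
  distribution Pr (mfun_pair V W) A =
    (distribution Pr V \x distribution Pr W)%E A.
Proof.
move=> VW A mA; apply/esym.
apply: (@product_measure_unique _ _ _ _ _ (distribution Pr V)
  (distribution Pr W) (distribution Pr (mfun_pair V W))) => //.
Qed.

Lemma distribution_result_le (d1 d2 : measure_display)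
    (S : measurableType d1) (T : measurableType d2)
    (g : randomized_map Pr S T) (Y Z : {RV Pr >-> S}) (c delta : R) :
  0 <= c -> 0 <= delta ->
  independent_RVs (seed g) Y -> independent_RVs (seed g) Z ->
  (forall B, measurable B ->
    (distribution Pr Y B <= c%:E * distribution Pr Z B + delta%:E)%E) ->
  forall E, measurable E ->
    (distribution Pr (result g Y) E <=
     c%:E * distribution Pr (result g Z) E + delta%:E)%E.
Proof.
move=> c0 delta0 gY gZ YZ E mE.
(* The seed comes first because the product measure integrates over its first factor: the section of
   [A] at a fixed seed is then an event about the input of [g]. *)
pose A := [set z : seed_space g * S | E (run g (z.2, z.1))].
have mA : measurable A.
  rewrite -[A]setTI.
  exact: (measurable_swap measurableT (measurable_funPTI (run g) mE)).
have resultE (V : {RV Pr >-> S}) : distribution Pr (result g V) E =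
  distribution Pr (mfun_pair (seed g) V) A by [].
rewrite !resultE !distribution_mfun_pair//.
exact: product_measure1_le.
Qed.

End randomized_postprocessing.

Theorem lemma2 (R : realType)
  (dO : measure_display) (Omega : measurableType dO) (Pr : probability Omega R)
  (dD : measure_display) (D : measurableType dD)
  (Rec : choiceType) (Ind : eqType) (DB : database_structure D Rec Ind)
  (X : {RV Pr >-> D}) (eps delta : R)
  (eps_gt0 : 0 < eps) (delta_ge0 : 0 <= delta) (delta_le1 : delta <= 1)
  (f : randomized_map Pr D (measurableTypeR R))
  (f_private : inherently_private DB X eps delta f)
  (dT : measure_display) (T : measurableType dT)
  (g : randomized_map Pr (measurableTypeR R) T)
  (g_indep : independent_RVs (seed g) (mfun_pair X (seed f))) :
  inherently_private DB X eps delta (randomized_comp g f).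
Proof.
(* To be used with [h := remove DB i]. The same seed of [f] serves [X] and [h \o X], so this result
   too is a function of the pair [(X, seed f)]. *)
have indep (h : {mfun D >-> D}) :
    independent_RVs (seed g) (result f (h \o X)).
  apply: (independent_RVs_comp (h := fun z => run f (h z.1, z.2)) _ _ g_indep).
    apply: (measurableT_comp (f := run f)) => //.
    apply/measurable_fun_pairP; split; last exact: measurable_snd.
    by apply: (measurableT_comp (f := h)) => //; exact: measurable_fst.
  by [].
have indepX : independent_RVs (seed g) (result f X).
  by apply: (independent_RVs_comp (h := run f) _ _ g_indep).
move=> i P P_i E mE; split.
- apply: (distribution_result_le (expR_ge0 _) delta_ge0 (indep _) indepX) => //.
  by move=> B mB; have [] := f_private i B mB.
- apply: (distribution_result_le (expR_ge0 _) delta_ge0 indepX (indep _)) => //.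
  by move=> B mB; have [] := f_private i B mB.
Qed.
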